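(* Let $g_c:[0,\infty)\to[0,\infty)$ be a measurable function with $0<K:=\int_0^\infty g_c(u)\,\mathrm{d}u<\infty$, let $\mu_1,\mu_2\in\mathbb{R}$, $\sigma>0$, $\rho\in(-1,1)$, $\boldsymbol{\mu}=(\mu_1,\mu_2)^\top$ and $\boldsymbol{\Sigma}=\begin{pmatrix}\sigma^2&\rho\sigma\\ \rho\sigma&1\end{pmatrix}$. Suppose $(Y^*,U^* )^\top$ has PDF $$f(\boldsymbol{y})=\frac{1}{|\boldsymbol{\Sigma}|^{1/2}\,\pi K}\,g_c\big((\boldsymbol{y}-\boldsymbol{\mu})^\top\boldsymbol{\Sigma}^{-1}(\boldsymbol{y}-\boldsymbol{\mu})\big),\qquad \boldsymbol{y}\in\mathbb{R}^2.$$ Let $V_1,V_2,R,D$ be mutually independent random variables with $\mathbb{P}(V_k=-1)=\mathbb{P}(V_k=1)=1/2$ for $k=1,2$, $D$ having PDF $\frac{2}{\pi\sqrt{1-d^2}}$ on $(0,1)$ and $R$ having PDF $\frac{2r g_c(r^2)}{K}$ on $(0,\infty)$; put $Z_1=RDV_1$, $Z_2=R\sqrt{1-D^2}V_2$, let $f_{Z_1}$ be the PDF of $Z_1$ and $f_{Z_2\mid Z_1}(w\mid z)=f_{Z_1,Z_2}(z,w)/f_{Z_1}(z)$ the conditional PDF of $Z_2$ given $Z_1=z$. Define $$H(x)=\int_{-x}^{\infty} f_{\rho Z_1+\sqrt{1-\rho^2}\,Z_2}(u)\,\mathrm{d}u,$$ and, for $y\in\mathbb{R}$ with $c_y:=(y-\mu_1)/\sigma$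 satisfying $f_{Z_1}(c_y)>0$, $$G_y(x)=\int_{-\infty}^{x} f_{Z_2\mid Z_1}(w\mid c_y)\,\mathrm{d}w .$$ Then $\mathbb{P}(U^*>0)=H(\mu_2)$, and (when this probability is positive) the PDF of $Y^*$ conditional on $U^*>0$ is $$f_{Y^*\mid U^*>0}(y)=\frac{1}{\sigma}\,f_{Z_1}\!\Big(\frac{y-\mu_1}{\sigma}\Big)\,\frac{G_y\Big(\frac{\mu_2}{\sqrt{1-\rho^2}}+\frac{\rho}{\sqrt{1-\rho^2}}\,\frac{y-\mu_1}{\sigma}\Big)}{H(\mu_2)},$$ with the right-hand side interpreted as $0$ when $f_{Z_1}((y-\mu_1)/\sigma)=0$.
   Context: $f_X$ denotes the PDF of a random variable $X$. The distribution of $(Y^*,U^* )^\top$ above is the bivariate symmetric distribution with location $\boldsymbol{\mu}$, scale matrix $\boldsymbol{\Sigma}$ and density generator $g_c$; note $|\boldsymbol{\Sigma}|=\sigma^2(1-\rho^2)$. *)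

(* Defs.v *)
From HB Require Import structures.
From mathcomp Require Import all_boot all_order all_algebra.
From mathcomp Require Import all_classical all_reals all_analysis.
Set Implicit Arguments. Unset Strict Implicit. Unset Printing Implicit Defensive.
Import Order.TTheory GRing.Theory Num.Theory.
Import numFieldNormedType.Exports.
Local Open Scope classical_set_scope.
Local Open Scope ring_scope.

Section Defs.
Context {R : realType} {d : measure_display} {Omega : measurableType d}.
Variable P : probability Omega R.

Definition is_pdf (X : Omega -> R) (f : R -> R) : Prop :=
  [/\ measurable_fun setT f, (forall x, 0 <= f x) &
      forall A : set R, measurable A ->
        P (X @^-1` A) = (\int[lebesgue_measure]_(x in A) (f x)%:E)%E].

Definition is_pdf2 (X Y : Omega -> R) (f : R * R -> R) : Prop :=
  [/\ measurable_fun setT f, (forall z, 0 <= f z) &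
      forall A : set (R * R), measurable A ->
        P ((fun w => (X w, Y w)) @^-1` A) =
        (\int[(lebesgue_measure \x lebesgue_measure)%E]_(z in A) (f z)%:E)%E].

Definition is_cond_pdf (X : Omega -> R) (E : set Omega) (h : R -> R) : Prop :=
  [/\ measurable_fun setT h, (forall x, 0 <= h x) &
      forall A : set R, measurable A ->
        ((fine (P (X @^-1` A `&` E)) / fine (P E))%:E =
         \int[lebesgue_measure]_(x in A) (h x)%:E)%E].

Definition mutually_independent4 (X1 X2 X3 X4 : Omega -> R) : Prop :=
  forall A1 A2 A3 A4 : set R,
    measurable A1 -> measurable A2 -> measurable A3 -> measurable A4 ->
    P (X1 @^-1` A1 `&` X2 @^-1` A2 `&` X3 @^-1` A3 `&` X4 @^-1` A4) =
    (P (X1 @^-1` A1) * P (X2 @^-1` A2) * P (X3 @^-1` A3) * P (X4 @^-1` A4))%E.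

End Defs.

Section Elliptical.
Context {R : realType}.

Definition Sigma2 (sigma rho : R) : 'M[R]_2 :=
  \matrix_(i < 2, j < 2)
    (if (i == j :> nat) then (if (i == 0%N :> nat) then sigma ^+ 2 else 1)
     else rho * sigma).

Definition quad_form (S : 'M[R]_2) (mu1 mu2 : R) (y : R * R) : R :=
  let v : 'rV[R]_2 := \row_(i < 2) (if (i == 0%N :> nat) then y.1 - mu1 else y.2 - mu2) in
  (v *m invmx S *m v^T) 0 0.

Definition ell_pdf (g : R -> R) (K mu1 mu2 sigma rho : R) (y : R * R) : R :=
  (Num.sqrt (\det (Sigma2 sigma rho)) * pi * K)^-1 *
  g (quad_form (Sigma2 sigma rho) mu1 mu2 y).

Definition pdf_D (x : R) : R :=
  if (0 < x) && (x < 1) then 2 / (pi * Num.sqrt (1 - x ^+ 2)) else 0.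

Definition pdf_R (g : R -> R) (K : R) (r : R) : R :=
  if 0 < r then 2 * r * g (r ^+ 2) / K else 0.

Definition Hfun (fS : R -> R) (x : R) : \bar R :=
  (\int[lebesgue_measure]_(u in `](- x)%R, +oo[) (fS u)%:E)%E.

Definition Gfun (fZ1 : R -> R) (fZ12 : R * R -> R) (c x : R) : \bar R :=
  (\int[lebesgue_measure]_(w in `]-oo, x]) (fZ12 (c, w) / fZ1 c)%:E)%E.

Definition cond_density (fZ1 : R -> R) (fZ12 : R * R -> R) (fS : R -> R)
    (mu1 mu2 sigma rho : R) (y : R) : R :=
  let c := (y - mu1) / sigma in
  if 0 < fZ1 c then
    sigma^-1 * fZ1 c *
    fine (Gfun fZ1 fZ12 c (mu2 / Num.sqrt (1 - rho ^+ 2) +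
                           rho / Num.sqrt (1 - rho ^+ 2) * c))
    / fine (Hfun fS mu2)
  else 0.

End Elliptical.

(* Main.v *)
Require Import Defs.
From HB Require Import structures.
From mathcomp Require Import all_boot all_order all_algebra.
From mathcomp Require Import all_classical all_reals all_analysis.
From mathcomp Require Import measurable_realfun ring lra.
Import Order.TTheory GRing.Theory Num.Theory.
Import numFieldNormedType.Exports.
Local Open Scope classical_set_scope.
Local Open Scope ring_scope.
Set Implicit Arguments.
Unset Strict Implicit.
Unset Printing Implicit Defensive.

(** On the event [V1 = e1, V2 = e2] the pair [(R, D)] keeps its product law, so
    the law of [(Z1, Z2)] on each quadrant is the image of that law under
    [(r, d) |-> (r d, r sqrt (1 - d ^ 2))].  This is polar coordinates with the
    angle parametrised by its cosine, and gives [(Z1, Z2)] the density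
    [g (x ^ 2 + y ^ 2) / (pi K)].  An affine change of variables then identifies
    the law of [(Ys, Us)] with that of
    [(mu1 + sigma Z1, mu2 + rho Z1 + s Z2)] for both square roots [s] of
    [1 - rho ^ 2].  The positive root gives the value of [P1 (Us > 0)]; the
    negative one turns [Us > 0] into an upper bound on [Z2], as in the
    definition of [Gfun]. *)

(** * Integration against a measure given by a density *)

Section integral_density.
Local Open Scope ereal_scope.
Context d (T : measurableType d) (R : realType).
Variables (m nu : {measure set T -> \bar R}) (h : T -> R).
Hypotheses (mh : measurable_fun setT h) (h0 : forall x, (0 <= h x)%R).
Hypothesis mE : forall A, measurable A -> m A = \int[nu]_(x in A) (h x)%:E.

Import HBNNSimple.

(** Monotone convergence along simple functions increasing to [f] reduces the claim to a finite sum
    over level sets, and on each level set it is [mE]. *)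
Lemma ge0_integral_density (f : T -> \bar R) :
  measurable_fun setT f -> (forall x, 0 <= f x) ->
  \int[m]_x f x = \int[nu]_x (f x * (h x)%:E).
Proof.
move=> mf f0; pose f_ := nnsfun_approx measurableT mf.
have mhE : measurable_fun setT (EFin \o h) by exact/measurable_EFinP.
transitivity (limn (fun n => \int[m]_x (f_ n x)%:E)).
  rewrite -monotone_convergence//.
  - apply: eq_integral => y _; apply/esym/cvg_lim => //.
    by apply: cvg_nnsfun_approx.
  - by move=> n; exact/measurable_EFinP/measurable_funP.
  - by move=> n y _; rewrite lee_fin.
  - by move=> y _ i j ij; rewrite lee_fin; exact/lefP/nd_nnsfun_approx.
transitivity (limn (fun n => \int[nu]_x ((f_ n x)%:E * (h x)%:E))); last first.
  rewrite -monotone_convergence//.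
  - apply: eq_integral => y _; apply/cvg_lim => //.
    by apply: cvgeZr => //; exact: cvg_nnsfun_approx.
  - move=> n; apply: emeasurable_funM => //.
    exact/measurable_EFinP/measurable_funP.
  - by move=> n y _; rewrite mule_ge0 ?lee_fin.
  - move=> y _ i j ij; rewrite lee_wpmul2r ?lee_fin//.
    exact/lefP/nd_nnsfun_approx.
congr (limn _); apply/funext => n.
have mr r : measurable (f_ n @^-1` [set r]) by exact: measurable_sfunP.
transitivity (\sum_(r \in range (f_ n)) (r%:E * m (f_ n @^-1` [set r]))).
  by rewrite integralT_nnsfun sintegralE.
under [RHS]eq_integral => x _.
  rewrite fimfunE -fsumEFin// ge0_mule_fsuml; last first.
    by move=> y; exact: nnfun_muleindic_ge0.
  over.
rewrite ge0_integral_fsum//; last 2 first.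
  - move=> r; apply: emeasurable_funM => //.
    by apply/measurable_EFinP; exact: measurable_funM.
  - by move=> r x _; rewrite mule_ge0 ?lee_fin//; exact: nnfun_muleindic_ge0.
apply: eq_fsbigr => r; rewrite inE => -[t _ <-].
under eq_integral do rewrite EFinM -muleA.
rewrite ge0_integralZl//.
- rewrite mE// integral_mkcond; congr (_ * _); apply: eq_integral => x _.
  by rewrite epatch_indic muleC.
- apply: emeasurable_funM => //; exact/measurable_EFinP.
- by move=> x _; rewrite mule_ge0 ?lee_fin.
- by rewrite lee_fin.
Qed.

End integral_density.

(** * Construction of the measure with a given density, and change of variables on the line *)

Section withdensity.
Context d (T : measurableType d) (R : realType).
Variables (mu : {measure set T -> \bar R}) (h : T -> R).

(** The two proofs are arguments so that the term itself carries what its measure structure rests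
    on. *)
Definition withdensity of measurable_fun setT h & (forall x, 0 <= h x) :=
  fun A : set T => (\int[mu]_(x in A) (h x)%:E)%E.

Hypotheses (mh : measurable_fun setT h) (h0 : forall x, 0 <= h x).

Let withdensity0 : withdensity mh h0 set0 = 0%E.
Proof. by rewrite /withdensity integral_set0. Qed.

Let withdensity_ge0 A : (0 <= withdensity mh h0 A)%E.
Proof. by rewrite /withdensity integral_ge0// => x _; rewrite lee_fin. Qed.

Let withdensity_sigma_additive : semi_sigma_additive (withdensity mh h0).
Proof.
move=> F mF tF mUF; rewrite /withdensity; apply: cvg_toP.
  apply: ereal_nondecreasing_is_cvgn => m n mn.
  by apply: lee_sum_nneg_natr => // k _ _; apply: integral_ge0 => x _;
    rewrite lee_fin.
rewrite ge0_integral_bigcup//=.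
- by apply/measurable_funTS/measurable_EFinP.
- by move=> x _; rewrite lee_fin.
Qed.

HB.instance Definition _ := isMeasure.Build _ _ _ (withdensity mh h0)
  withdensity0 withdensity_ge0 withdensity_sigma_additive.

End withdensity.

(* The hypothesis on half-open intervals says that the image under [phi] of
   the measure of density [h] is the Lebesgue measure. *)
Lemma ge0_substitution (R : realType) (phi h : R -> R) :
  measurable_fun setT phi -> measurable_fun setT h -> (forall x, 0 <= h x) ->
  (forall a b : R, (a < b)%R ->
    \int[lebesgue_measure]_(y in phi @^-1` `]a, b]) (h y)%:E = (b - a)%:E)%E ->
  forall f : R -> \bar R, measurable_fun setT f -> (forall x, 0 <= f x)%E ->
  (\int[lebesgue_measure]_x f x =
   \int[lebesgue_measure]_y (f (phi y) * (h y)%:E))%E.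
Proof.
move=> mphi mh h0 Hab f mf f0.
pose nu : {measure set (measurableTypeR R) -> \bar R} :=
  withdensity lebesgue_measure mh h0.
pose pf : {measure set (measurableTypeR R) -> \bar R} :=
  @measure_function_pushforward__canonical__measure_function_Measure
    _ _ (measurableTypeR R) (measurableTypeR R) R nu phi mphi.
(* Lebesgue measure is determined by its values on half-open intervals, and [Hab] gives those values
   for [pf]; when [b <= a] both sides are zero. *)
have nuE A : measurable A -> lebesgue_measure A = pf A.
  move=> mA; refine (@lebesgue_measure_unique _ pf _ A mA) => {A mA}.
  move=> _ [[a b]] _ <-.
  rewrite [LHS]lebesgue_measure_itv /= /pf /pushforward /nu /= /withdensity lte_fin.
  case: ltP => ab; first by rewrite Hab// EFinB.
  by rewrite set_itv_ge ?preimage_set0 ?integral_set0// bnd_simp -leNgt.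
rewrite (eq_measure_integral pf); last first.
  by move=> A mA _; exact: nuE.
rewrite (@ge0_integral_pushforward _ _ (measurableTypeR R) (measurableTypeR R))//=.
rewrite preimage_setT.
rewrite (@ge0_integral_density _ _ _ nu lebesgue_measure h)//.
exact: measurableT_comp.
Qed.

(** * Affine and quadratic substitutions *)

Section substitution.
Context {R : realType}.
Local Notation mu := (@lebesgue_measure R).

Lemma ge0_substitution_affine (a b : R) : a != 0 ->
  forall f : R -> \bar R, measurable_fun setT f -> (forall x, 0 <= f x)%E ->
  (\int[mu]_x f x = \int[mu]_y (f (a * y + b)%R * `|a|%:E))%E.
Proof.
move=> a0 f mf f0; apply: (@ge0_substitution R (fun y => a * y + b) (cst `|a|)) => //.
  by apply: measurable_funD => //; exact: measurable_funM.
move=> p q pq.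
have [ap|an|/eqP] := ltgtP 0 a; last by rewrite eq_sym (negbTE a0).
  rewrite (_ : _ @^-1` _ = `](p - b) / a, (q - b) / a]%classic); last first.
    apply/seteqP; split=> y /=; rewrite !in_itv/=;
      by rewrite ltr_pdivrMr// ler_pdivlMr// ltrBlDr lerBrDr (mulrC a).
  rewrite (eq_integral (cst `|a|%:E))// integral_cst//= lebesgue_measure_itv/= lte_fin.
  rewrite ltr_pM2r ?invr_gt0// ltrD2r pq -EFinD -EFinM; congr EFin.
  by rewrite gtr0_norm//; field.
(* A negative slope swaps the endpoints and the side that is closed; the length is unaffected. *)
rewrite (_ : _ @^-1` _ = `[(q - b) / a, (p - b) / a[%classic); last first.
  apply/seteqP; split=> y /=; rewrite !in_itv/=;
    by rewrite ltr_ndivlMr// ler_ndivrMr// ltrBlDr lerBrDr (mulrC a) andbC.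
rewrite (eq_integral (cst `|a|%:E))// integral_cst//= lebesgue_measure_itv/= lte_fin.
rewrite ltr_nM2r ?invr_lt0// ltrD2r pq -EFinD -EFinM; congr EFin.
by rewrite ltr0_norm//; field.
Qed.

Lemma integral_doubled (a b : R) : 0 <= a -> a < b ->
  (\int[mu]_(y in `]a, b]) (2 * y)%:E = (b ^+ 2 - a ^+ 2)%:E)%E.
Proof.
move=> a0 ab.
rewrite integral_itv_obnd_cbnd; last first.
  by apply/measurable_EFinP/measurable_funM.
rewrite (@continuous_FTC2 _ (fun y => 2 * y) (fun y => y ^+ 2))// ?EFinB//.
- apply: continuous_subspaceT => x; apply: cvgM; [exact: cvg_cst|exact: cvg_id].
- split=> [x _| |].
  + exact: exprn_derivable.
  + by apply: cvg_at_right_filter; exact: exprn_continuous.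
  + by apply: cvg_at_left_filter; exact: exprn_continuous.
- by move=> x _; rewrite derive1E exp_derive/= expr1 /GRing.scale/= mulr1 mulr_natl.
Qed.

Lemma ge0_substitution_sqr (f : R -> \bar R) :
  measurable_fun setT f -> (forall x, 0 <= f x)%E ->
  (\int[mu]_(t in `]0%R, +oo[) f t =
   \int[mu]_(y in `]0%R, +oo[) (f (y ^+ 2)%R * (2 * y)%:E))%E.
Proof.
move=> mf f0.
(* Squaring is not injective on the line, so it is continued by the identity on the nonpositive
   half-line, with density 1 there. This gives an increasing bijection of the whole line to which
   [ge0_substitution] applies. *)
pose phi (y : R) := if 0 < y then y ^+ 2 else y.
pose h (y : R) := if 0 < y then 2 * y else 1.
have mlt : measurable_fun setT (fun y : R => 0 < y) by exact: measurable_fun_ltr.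
rewrite [LHS]integral_mkcond (@ge0_substitution R phi h).
- rewrite [RHS]integral_mkcond; apply: eq_integral => y _.
  rewrite /phi /h !patchE !mem_setE/= !in_itv/= !andbT.
  by case: (boolP (0 < y)) => [y0|/negbTE y0]; rewrite ?exprn_gt0// ?y0 ?mul0e.
- by apply: measurable_fun_ifT => //; exact: measurable_funX.
- by apply: measurable_fun_ifT => //; exact: measurable_funM.
- by move=> x; rewrite /h; case: ifPn => // x0; rewrite mulr_ge0// ltW.
- move=> a b ab.
  (* [s] inverts [phi]; as [phi] is strictly increasing, the preimage of an interval is the interval
     between the values of [s] at its endpoints. *)
  pose s (x : R) := if 0 < x then Num.sqrt x else x.
  have sK x : phi (s x) = x.
    rewrite /phi /s; case: (ltP 0 x) => x0; last by rewrite ltNge x0.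
    by rewrite sqrtr_gt0 x0 sqr_sqrtr// ltW.
  have phi_lt : {mono phi : x y / x < y}.
    apply: leW_mono; apply: le_mono => x y xy; rewrite /phi.
    case: (ltP 0 x) => x0; case: (ltP 0 y) => y0 //.
    - by rewrite ltr_pXn2r// ?nnegrE ltW.
    - by have := lt_le_trans (lt_trans x0 xy) y0; rewrite ltxx.
    - by rewrite (le_lt_trans x0)// exprn_gt0.
  have -> : phi @^-1` `]a, b] = `]s a, s b]%classic.
    have phi_itv y : (a < phi y <= b) = (s a < y <= s b).
      by rewrite -[in LHS](sK a) -[in LHS](sK b) phi_lt !leNgt phi_lt.
    by apply/seteqP; split=> y /=; rewrite !in_itv/= phi_itv.
  have neg_part (p q : R) : p < q -> q <= 0 ->
      (\int[mu]_(y in `]p, q]) (h y)%:E = (q - p)%:E)%E.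
    move=> pq q0; rewrite (eq_integral (cst 1%E)).
      by rewrite integral_cst//= lebesgue_measure_itv/= lte_fin pq mul1e -EFinB.
    move=> y; rewrite inE/= in_itv/= => /andP[_ yq].
    by rewrite /h ltNge (le_trans yq q0).
  have pos_part (p q : R) : 0 <= p -> p < q ->
      (\int[mu]_(y in `]p, q]) (h y)%:E = (q ^+ 2 - p ^+ 2)%:E)%E.
    move=> p0 pq; rewrite -integral_doubled//; apply: eq_integral.
    move=> y; rewrite inE/= in_itv/= => /andP[py _].
    by rewrite /h (le_lt_trans p0 py).
  have [b0|b0] := leP b 0.
    by rewrite /s !ltNge b0 (le_trans (ltW ab) b0)/= neg_part.
  have sb0 : 0 < s b by rewrite /s b0 sqrtr_gt0.
  have sb2 : s b ^+ 2 = b by rewrite -[RHS]sK /phi sb0.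
  have [a0|a0] := leP 0 a.
    have sa0 : 0 <= s a by rewrite /s; case: ifP => // _; exact: sqrtr_ge0.
    have sa2 : s a ^+ 2 = a.
      by rewrite /s; case: ltP => [_|a0']; [rewrite sqr_sqrtr|
        have -> : a = 0 by apply/le_anti/andP]; rewrite ?expr0n.
    by rewrite pos_part ?sb2 ?sa2// -phi_lt !sK.
  (* In the remaining case [a < 0 < b] the interval is cut at 0, and the two parts have masses [- a]
     and [b]. *)
  have -> : s a = a by rewrite /s ltNge ltW.
  rewrite (@itv_bndbnd_setU _ _ (BRight a) (BRight (0:R)) (BRight (s b)));
    rewrite ?bnd_simp ?ltW//.
  rewrite ge0_integral_setU//=; first last.
  + apply/disj_setPRL => y /=; rewrite !in_itv/= => /andP[y0 _].
    by apply/negP; rewrite negb_and -ltNge y0 orbT.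
  + by move=> y _; rewrite lee_fin /h; case: ifPn => // y0; rewrite mulr_ge0// ltW.
  + apply/measurable_funTS/measurable_EFinP.
    by apply: measurable_fun_ifT => //; exact: measurable_funM.
  + by rewrite neg_part// pos_part// sb2 -EFinD; congr EFin; ring.
- by apply/(measurable_restrictT _ _).1 => //; exact: measurable_funTS.
- by move=> x; rewrite patchE; case: ifP.
Qed.
End substitution.

(** * Measurability of inverses and square roots *)

Section measurability.
Context {R : realType}.

(* [powR x (-1)] is the inverse on nonnegative reals only. *)
Lemma measurable_invr : measurable_fun setT (@GRing.inv R).
Proof.
rewrite (_ : GRing.inv = fun x : R =>
    if x < 0 then - powR (- x) (-1) else powR x (-1)); last first.
  apply/funext => x; case: ltP => x0; last by rewrite powR_inv1.
  by rewrite powR_inv1 ?invrN ?opprK// oppr_ge0 ltW.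
apply: measurable_fun_ifT; first exact: measurable_fun_ltr.
  apply: measurable_funN.
  exact: (@measurableT_comp _ _ _ R R R (fun y => powR y (-1)) setT -%R).
exact: measurable_powR.
Qed.

Lemma measurable_sqrt : measurable_fun setT (@Num.sqrt R).
Proof. by apply: continuous_measurable_fun; exact: sqrt_continuous. Qed.

Lemma measurable_funTV d (T : measurableType d) (f : T -> R) :
  measurable_fun setT f -> measurable_fun setT (fun x => (f x)^-1).
Proof. by move=> mf; exact: measurableT_comp measurable_invr mf. Qed.

Lemma measurable_funT_sqrt d (T : measurableType d) (f : T -> R) :
  measurable_fun setT f -> measurable_fun setT (fun x => Num.sqrt (f x)).
Proof. by move=> mf; exact: measurableT_comp measurable_sqrt mf. Qed.

End measurability.

(** * Polar coordinates on the positive quadrant *)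

Section polar_coordinates.
Context {R : realType}.
Local Notation mu := (@lebesgue_measure R).

(* The substitutions [d = x / r], [r ^ 2 = t], [t = x ^ 2 + s] and [s = y ^ 2]
   are affine or squares; [Q (x, s)] is the integrand in the variables
   [(x, s)], extended by zero. *)
Lemma polar_coordinates_quadrant (F : R * R -> \bar R) :
  measurable_fun setT F -> (forall z, 0 <= F z)%E ->
  (\int[mu]_(r in `]0%R, +oo[)
     (\int[mu]_(d in `]0%R, 1%R[)
        (F (r * d, r * Num.sqrt (1 - d ^+ 2))%R *
         ((Num.sqrt (1 - d ^+ 2))^-1)%:E) * r%:E) =
   \int[mu]_(x in `]0%R, +oo[) \int[mu]_(y in `]0%R, +oo[) F (x, y))%E.
Proof.
move=> mF F0.
pose Q (z : R * R) : \bar R := if (0 < z.1) && (0 < z.2) then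
  (F (z.1, Num.sqrt z.2) * ((2 * Num.sqrt z.2)^-1)%:E)%E else 0%E.
have mQ : measurable_fun setT Q.
  apply: measurable_fun_ifT.
  - by apply: measurable_and; apply: measurable_fun_ltr => //.
  - apply: emeasurable_funM.
      apply: measurableT_comp => //; apply: measurable_fun_pair => //.
      exact: measurable_funT_sqrt.
    apply/measurable_EFinP; apply: measurable_funTV.
    by apply: measurable_funM => //; exact: measurable_funT_sqrt.
  - by [].
have Q0 z : (0 <= Q z)%E.
  rewrite /Q; case: ifP => // _; rewrite mule_ge0// lee_fin invr_ge0 mulr_ge0.
(* The coordinates of [Q'] are [(t, x)], where [t] is the squared radius and [s = t - x ^ 2]. *)
pose Q' (z : R * R) := Q (z.2, z.1 - z.2 ^+ 2).
have mQ' : measurable_fun setT Q'.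
  apply: measurableT_comp => //; apply: measurable_fun_pair => //.
  by apply: measurable_funB => //; exact: measurable_funX.
pose Phi t : \bar R := (\int[mu]_x Q' (t, x))%E.
have mPhi : measurable_fun setT Phi.
  refine (@measurable_fun_fubini_tonelli_F _ _ (measurableTypeR R)
    (measurableTypeR R) R mu Q' mQ' (fun z => Q0 _)).
have Phi0 t : (0 <= Phi t)%E by apply: integral_ge0 => x _; exact: Q0.
(* At fixed [r] the substitution is [x = r d]. Its Jacobian [r] cancels the [r] in
   [s = r ^ 2 (1 - d ^ 2)] under the root, and the factor 2 undoes the one in [Q]. The positivity
   tests in [Q] amount to [0 < d < 1]. *)
have PhiE (r : R) : 0 < r ->
    (\int[mu]_(d in `]0%R, 1%R[)
        (F (r * d, r * Num.sqrt (1 - d ^+ 2))%R *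
         ((Num.sqrt (1 - d ^+ 2))^-1)%:E) = Phi (r ^+ 2)%R * 2%:E)%E.
  move=> r0.
  have mQ'r : measurable_fun setT (fun x => Q' (r ^+ 2, x)).
    exact: (@measurable_fun_pair2 _ _ _ R R _ Q' (r ^+ 2)).
  have maff : measurable_fun setT (fun d : R => r * d + 0).
    by apply: measurable_funD => //; exact: measurable_funM.
  rewrite /Phi (@ge0_substitution_affine R r 0 _ (fun x => Q' (r ^+ 2, x))); rewrite ?gt_eqF//; last by move=> x; exact: Q0.
  rewrite -ge0_integralZr//; first last.
  - by move=> d _; rewrite mule_ge0 ?lee_fin//; exact: Q0.
  - apply: emeasurable_funM => //.
    exact: (measurableT_comp mQ'r maff).
  rewrite [LHS]integral_mkcond; apply: eq_integral => d _.
  rewrite patchE mem_setE/= in_itv/= addr0 /Q' /Q/= pmulr_rgt0//.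
  case: (ltP 0 d) => d0 /=; last by rewrite !mul0e.
  have -> : r ^+ 2 - (r * d) ^+ 2 = r ^+ 2 * (1 - d ^+ 2) by ring.
  rewrite pmulr_rgt0 ?exprn_gt0// subr_gt0.
  rewrite expr_lt1 ?ltW//.
  case: ifPn => d1; last by rewrite !mul0e.
  rewrite sqrtrM ?sqr_ge0// sqrtr_sqr (gtr0_norm r0).
  rewrite -!muleA -!EFinM; congr (_ * _%:E)%E.
  have sd0 : Num.sqrt (1 - d ^+ 2) != 0.
    by rewrite sqrtr_eq0 -ltNge subr_gt0 expr_lt1 ?ltW.
  by field; rewrite sd0 gt_eqF.
transitivity (\int[mu]_(r in `]0%R, +oo[) (Phi (r ^+ 2)%R * (2 * r)%:E))%E.
  apply: eq_integral => r; rewrite inE/= in_itv/= andbT => r0.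
  by rewrite PhiE// EFinM muleA.
rewrite -ge0_substitution_sqr//.
(* [Phi] vanishes for [t <= 0], since then [t - x ^ 2] is never positive. *)
transitivity (\int[mu]_t Phi t)%E.
  rewrite integral_mkcond; apply: eq_integral => t _; rewrite patchE.
  case: ifPn => //; rewrite notin_setE/= in_itv/= andbT => /negP; rewrite -leNgt => t0.
  rewrite /Phi integral0_eq// => x _; rewrite /Q' /Q /= ltNge.
  rewrite subr_gt0 ltNge (le_trans t0) ?sqr_ge0 ?andbF//.
(* With the order of integration exchanged, [x] is fixed and [t = x ^ 2 + s] is a mere translation
   in [s]. *)
rewrite (@fubini_tonelli _ _ _ _ _ mu mu Q')//; last by move=> z; exact: Q0.
rewrite [RHS]integral_mkcond; apply: eq_integral => x _; rewrite patchE mem_setE/= in_itv/= andbT.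
have mQx : measurable_fun setT (fun s => Q (x, s)).
  exact: (@measurable_fun_pair2 _ _ _ R R _ Q x).
transitivity (\int[mu]_s Q (x, s))%E.
  rewrite [RHS](@ge0_substitution_affine _ 1 (- x ^+ 2))//.
  by apply: eq_integral => t _; rewrite /Q'/= mul1r normr1 mule1.
case: ifPn => x0; last first.
  by rewrite integral0_eq// => s _; rewrite /Q/= (negbTE x0).
transitivity (\int[mu]_(s in `]0%R, +oo[) Q (x, s))%E.
  rewrite [RHS]integral_mkcond; apply: eq_integral => s _; rewrite patchE.
  case: ifPn => //; rewrite notin_setE/= in_itv/= andbT => /negP/negbTE s0.
  by rewrite /Q/= s0 andbF.
(* Putting [s = y ^ 2] brings the Jacobian [2 y], which cancels the factor [1 / (2 sqrt s)] built
   into [Q]. *)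
rewrite (@ge0_substitution_sqr R (fun s => Q (x, s)))//.
apply: eq_integral => y; rewrite inE/= in_itv/= andbT => y0.
rewrite /Q/= x0 exprn_gt0//= sqrtr_sqr gtr0_norm// -muleA -EFinM.
by rewrite mulVf ?mule1// mulf_neq0// gt_eqF.
Qed.

End polar_coordinates.

(** * Iterated integrals and laws given by PDFs *)

Section lebesgue2.
Context {R : realType}.
Local Notation mu := (@lebesgue_measure R).
Variable f : R * R -> \bar R.
Hypotheses (mf : measurable_fun setT f) (f0 : forall z, (0 <= f z)%E).

Lemma measurable_integral_lebesgue :
  measurable_fun setT (fun x => \int[mu]_y f (x, y))%E.
Proof.
refine (@measurable_fun_fubini_tonelli_F _ _ (measurableTypeR R)
  (measurableTypeR R) R mu f mf f0).
Qed.

Lemma integral_lebesgue2 :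
  (\int[mu \x mu]_z f z = \int[mu]_x \int[mu]_y f (x, y))%E.
Proof. exact: (@fubini_tonelli1 _ _ _ _ _ mu mu f). Qed.

End lebesgue2.

Section integral_pdf.
Context {R : realType} {d : measure_display} {T : measurableType d}.
Variable P : probability T R.
Local Notation mu := (@lebesgue_measure R).

(** The image of [P] under [X] has density [h], so [ge0_integral_density] applies to it. *)
Lemma ge0_integral_is_pdf (X : T -> R) (h : R -> R) (F : R -> \bar R) :
  measurable_fun setT X -> is_pdf P X h ->
  measurable_fun setT F -> (forall x, 0 <= F x)%E ->
  (\int[P]_w F (X w) = \int[mu]_x (F x * (h x)%:E))%E.
Proof.
move=> mX [mh h0 hE] mF F0.
pose m : {measure set (measurableTypeR R) -> \bar R} :=
  @measure_function_pushforward__canonical__measure_function_Measure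
    _ _ _ (measurableTypeR R) R P X mX.
rewrite -(@ge0_integral_density _ _ R m mu h)//.
exact/esym/(@ge0_integral_pushforward _ _ _ (measurableTypeR R)).
Qed.

Lemma is_pdf2E (X Y : T -> R) (h : R * R -> R) (B : set (R * R)) :
  is_pdf2 P X Y h -> measurable B ->
  P ((fun w => (X w, Y w)) @^-1` B) =
  (\int[mu]_x \int[mu]_y (\1_B (x, y) * h (x, y))%:E)%E.
Proof.
move=> [mh h0 PE] mB; rewrite PE//.
rewrite -(integral_lebesgue2 (f := fun z => (\1_B z * h z)%:E)).
- rewrite integral_mkcond; apply: eq_integral => z _.
  by rewrite patchE indicE; case: ifP; rewrite ?mul1r ?mul0r.
- by apply/measurable_EFinP; apply: measurable_funM => //; exact: measurable_indic.
- by move=> z; rewrite lee_fin mulr_ge0.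
Qed.

End integral_pdf.

(** * Joint law of an independent pair on an event *)

Section independence.
Context {R : realType} {d : measure_display} {T : measurableType d}.
Variable P : probability T R.
Local Notation mu := (@lebesgue_measure R).

(** The law of [(X, Y)] restricted to [E] and divided by [c] agrees with the product of the two laws
    on rectangles, hence everywhere by uniqueness of the product measure; Tonelli then gives the
    iterated integral. In the application [E] fixes the two signs and [c] is 1/4. *)
Lemma probability_indep_pair (X Y : T -> R) (fX fY : R -> R) (E : set T) (c : R) :
  measurable_fun setT X -> measurable_fun setT Y -> measurable E -> 0 < c ->
  is_pdf P X fX -> is_pdf P Y fY ->
  (forall A B : set R, measurable A -> measurable B ->
    P (E `&` X @^-1` A `&` Y @^-1` B) =
    (c%:E * (P (X @^-1` A) * P (Y @^-1` B)))%E) ->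
  forall C : set (R * R), measurable C ->
  P (E `&` (fun w => (X w, Y w)) @^-1` C) =
  (c%:E * \int[mu]_x (\int[mu]_y (\1_C (x, y) * fY y)%:E * (fX x)%:E))%E.
Proof.
move=> mX mY mE c0 hX hY ind C mC.
have mXY : measurable_fun setT (fun w => (X w, Y w)).
  exact: measurable_fun_pair.
pose X' : {mfun T >-> R} := HB.pack X (isMeasurableFun.Build _ _ _ _ _ mX).
pose Y' : {mfun T >-> R} := HB.pack Y (isMeasurableFun.Build _ _ _ _ _ mY).
have ic0 : 0 <= c^-1 by rewrite invr_ge0 ltW.
pose m0 : {measure set (R * R)%type -> \bar R} :=
  @measure_function_pushforward__canonical__measure_function_Measure
    _ _ _ (R * R)%type R (mrestr P mE) _ mXY.
pose m : {measure set (R * R)%type -> \bar R} := mscale (NngNum ic0) m0.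
have PE D : m0 D = P (E `&` (fun w => (X w, Y w)) @^-1` D) by rewrite setIC.
have mD D : m D = (c^-1%:E * P (E `&` (fun w => (X w, Y w)) @^-1` D))%E.
  by rewrite -PE.
have mE2 : (distribution P X' \x distribution P Y')%E C = m C.
  apply: product_measure_unique => // A B mA mB.
  rewrite mD.
  have -> : E `&` (fun w => (X w, Y w)) @^-1` (A `*` B) =
            E `&` X @^-1` A `&` Y @^-1` B.
    by apply/seteqP; split=> w /=; [case=> ? [? ?]|case=> -[? ?] ?].
  by rewrite ind// muleA -EFinM mulVf ?gt_eqF// mul1e.
have -> : P (E `&` (fun w => (X w, Y w)) @^-1` C) = (c%:E * m C)%E.
  by rewrite mD muleA -EFinM divff ?gt_eqF// mul1e.
congr (_ * _)%E.
have -> : m C = (\int[distribution P X' \x distribution P Y']_z (\1_C z)%:E)%E.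
  by rewrite -mE2 integral_indic// setIT.
have m1C : measurable_fun setT (EFin \o (\1_C : R * R -> R)).
  by apply/measurable_EFinP; exact: measurable_indic.
rewrite (fubini_tonelli1 (EFin \o \1_C))//=.
have mint : measurable_fun setT
    (fun x => \int[distribution P Y']_y (\1_C (x, y))%:E)%E.
  apply: (@measurable_fun_fubini_tonelli_F _ _ R R R (distribution P Y')
    (EFin \o \1_C)) => //.
  by move=> z; rewrite lee_fin.
rewrite /fubini_F ge0_integral_pushforward//=; last first.
  by move=> x _; apply: integral_ge0 => y _; rewrite lee_fin.
rewrite preimage_setT (ge0_integral_is_pdf (h := fX)
  (F := fun x => \int[distribution P Y']_y (\1_C (x, y))%:E)%E)//; last first.
  by move=> x; apply: integral_ge0 => y _; rewrite lee_fin.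
apply: eq_integral => x _; congr (_ * _)%E.
have m1Cx : measurable_fun setT (fun y => (\1_C (x, y))%:E : \bar R).
  exact: (@measurable_fun_pair2 _ _ _ R R _ (EFin \o \1_C) x).
rewrite ge0_integral_pushforward//=.
rewrite preimage_setT (ge0_integral_is_pdf (h := fY)
  (F := fun y => (\1_C (x, y))%:E))//.
Qed.
End independence.

(** * The spherical law of [(Z1, Z2)] *)

Section spherical.
Context {R : realType}.
Local Notation mu := (@lebesgue_measure R).

(** The case of zero location and identity scale matrix. In polar coordinates the integral of
    [g (x ^ 2 + y ^ 2)] over the plane is [pi] times that of [g] over the half-line, whence the
    constant [pi K]. *)
Definition spherical_pdf (g : R -> R) (K : R) (z : R * R) : R :=
  (pi * K)^-1 * g (z.1 ^+ 2 + z.2 ^+ 2).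

Variables (g : R -> R) (K : R).
Hypotheses (mg : measurable_fun (`[0%R, +oo[ : set R) g)
  (g0 : forall u, 0 <= u -> 0 <= g u) (K0 : 0 < K).

Lemma spherical_pdf_ge0 z : 0 <= spherical_pdf g K z.
Proof.
rewrite mulr_ge0// ?g0 ?addr_ge0 ?sqr_ge0//.
by rewrite invr_ge0 mulr_ge0 ?pi_ge0// ltW.
Qed.

(** [g] is measurable on the nonnegative half-line only; as its argument is a sum of squares, it may
    be replaced by its extension by zero. *)
Lemma measurable_spherical_pdf : measurable_fun setT (spherical_pdf g K).
Proof.
have mg' : measurable_fun setT (g \_ `[0%R, +oo[).
  by apply/(measurable_restrictT _ _).1.
rewrite (_ : spherical_pdf g K = fun z => (pi * K)^-1 *
    (g \_ `[0%R, +oo[) (z.1 ^+ 2 + z.2 ^+ 2)).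
  apply: measurable_funM => //; apply: (measurableT_comp mg').
  by apply: measurable_funD; exact: measurable_funX.
apply/funext => z; rewrite /spherical_pdf patchE mem_setE/= in_itv/= andbT.
by rewrite addr_ge0 ?sqr_ge0.
Qed.

Lemma ge0_integral_half (f : R -> \bar R) :
  measurable_fun setT f -> (forall x, 0 <= f x)%E ->
  (\int[mu]_x f x = \int[mu]_(x in `]0%R, +oo[) (f x + f (- x)%R))%E.
Proof.
move=> mf f0.
have mfN : measurable_fun setT (fun x : R => f (- x)).
  exact: (@measurableT_comp _ _ _ R R _ f setT -%R).
rewrite ge0_integralD//; try exact: measurable_funTS.
rewrite (_ : setT = `]0%R, +oo[ `|` `]-oo, 0%R]); last first.
  apply/seteqP; split=> // y _ /=; rewrite !in_itv/= andbT.
  by case: (ltP 0 y); [left|right].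
rewrite ge0_integral_setU//=.
- congr (_ + _)%E.
  (* The point 0 is negligible; adding it makes the domain the mirror image of the closed
     half-line. *)
  rewrite [RHS]integral_itv_obnd_cbnd; last exact: measurable_funTS.
  rewrite (ge0_integration_by_substitution0 (f := fun x => f (- x)))//.
  by apply: eq_integral => x _; rewrite opprK.
- exact: measurable_funTS.
- apply/disj_setPRL => y /=; rewrite !in_itv/= => y0.
  by rewrite andbT; apply/negP; rewrite -leNgt.
Qed.

Section law.
Context d (T : measurableType d) (P : probability T R).
Variables V1 V2 Rr D : T -> R.
Hypotheses (mV1 : measurable_fun setT V1) (mV2 : measurable_fun setT V2)
  (mR : measurable_fun setT Rr) (mD : measurable_fun setT D)
  (ind : mutually_independent4 P V1 V2 Rr D)
  (hD : is_pdf P D pdf_D) (hR : is_pdf P Rr (pdf_R g K)).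

Lemma measurable_preimage (X : T -> R) (A : set R) :
  measurable_fun setT X -> measurable A -> measurable (X @^-1` A).
Proof. by move=> mX mA; rewrite -[_ @^-1` _]setTI; exact: mX. Qed.

(** Once the signs are fixed, the pair is a function of [(Rr, D)], and the event contributes a
    factor 1/4. The product of 1/4 and the two PDFs is [r g (r ^ 2) / (pi K sqrt (1 - d ^ 2))],
    which is the polar form of [spherical_pdf]. *)
Lemma spherical_law_quadrant (e1 e2 : R) (B : set (R * R)) : measurable B ->
  P (V1 @^-1` [set e1]) = (1 / 2)%:E -> P (V2 @^-1` [set e2]) = (1 / 2)%:E ->
  P (V1 @^-1` [set e1] `&` V2 @^-1` [set e2] `&`
     (fun w => (Rr w * D w * V1 w, Rr w * Num.sqrt (1 - D w ^+ 2) * V2 w))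
       @^-1` B) =
  (\int[mu]_(x in `]0%R, +oo[) \int[mu]_(y in `]0%R, +oo[)
     (\1_B (x * e1, y * e2)%R * spherical_pdf g K (x, y))%:E)%E.
Proof.
move=> mB PV1 PV2.
pose c (z : R * R) := (z.1 * z.2 * e1, z.1 * Num.sqrt (1 - z.2 ^+ 2) * e2).
have mc : measurable_fun setT c.
  apply: measurable_fun_pair; apply: measurable_funM => //.
    exact: measurable_funM.
  apply: measurable_funM => //; apply: measurable_funT_sqrt.
  by apply: measurable_funB => //; exact: measurable_funX.
have mC : measurable (c @^-1` B) by rewrite -[_ @^-1` _]setTI; exact: mc.
set E := V1 @^-1` [set e1] `&` V2 @^-1` [set e2].
have mE : measurable E by apply: measurableI; exact: measurable_preimage.
have -> : E `&` (fun w => (Rr w * D w * V1 w,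
      Rr w * Num.sqrt (1 - D w ^+ 2) * V2 w)) @^-1` B =
    E `&` (fun w => (Rr w, D w)) @^-1` (c @^-1` B).
  apply/seteqP; split=> w /= [[ev1 ev2] Bw]; split=> //; move: Bw;
    by rewrite /c/= ev1 ev2.
have c4 : 0 < 4^-1 :> R by rewrite invr_gt0.
rewrite (@probability_indep_pair _ _ _ P Rr D (pdf_R g K) pdf_D E 4^-1)//;
  last first.
  move=> A1 A2 mA1 mA2; rewrite ind// PV1 PV2 -!muleA (muleA (1 / 2)%:E).
  by rewrite -EFinM; congr (_%:E * _)%E; field.
have mh1 : measurable_fun setT (fun z : R * R => (z.1 * e1, z.2 * e2)).
  by apply: measurable_fun_pair; exact: measurable_funM.
pose F (z : R * R) := (\1_B (z.1 * e1, z.2 * e2)%R * spherical_pdf g K z)%:E.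
have mF : measurable_fun setT F.
  apply/measurable_EFinP; apply: measurable_funM.
    have m1B : measurable_fun setT (\1_B : R * R -> R) by exact: measurable_indic.
    exact: (measurableT_comp m1B mh1).
  exact: measurable_spherical_pdf.
have F0 z : (0 <= F z)%E by rewrite lee_fin mulr_ge0// spherical_pdf_ge0.
rewrite -[RHS](polar_coordinates_quadrant mF F0).
pose I r := (\int[mu]_d (\1_(c @^-1` B) (r, d) * pdf_D d)%:E)%E.
have mhI : measurable_fun setT
    (fun z : R * R => (\1_(c @^-1` B) z * pdf_D z.2)%:E : \bar R).
  apply/measurable_EFinP; apply: measurable_funM; first exact: measurable_indic.
  by case: hD => mpD _ _; exact: (measurableT_comp mpD).
have mI : measurable_fun setT I.
  apply: (measurable_integral_lebesgue mhI) => z.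
  by rewrite lee_fin mulr_ge0//; case: hD.
have I0 r : (0 <= I r)%E.
  by apply: integral_ge0 => y _; rewrite lee_fin mulr_ge0//; case: hD.
rewrite -ge0_integralZl//; first last.
- by move=> r _; apply: mule_ge0; [exact: I0|rewrite lee_fin; case: hR].
- by apply: emeasurable_funM => //; apply/measurable_EFinP; case: hR.
rewrite [RHS]integral_mkcond; apply: eq_integral => r _.
rewrite -/(I r) patchE mem_setE/= in_itv/= andbT /pdf_R.
case: ifPn => r0; last by rewrite !mule0.
(* For fixed [r] both sides are multiples of [J]: the radius of the image point is [r], so the value
   of [g] leaves the integral over [d]. *)
pose J := (\int[mu]_(d in `]0%R, 1%R[)
  (\1_(c @^-1` B) (r, d) * (Num.sqrt (1 - d ^+ 2))^-1)%:E)%E.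
have mJ : measurable_fun setT (fun d : R =>
    (\1_(c @^-1` B) (r, d) * (Num.sqrt (1 - d ^+ 2))^-1)%:E : \bar R).
  apply/measurable_EFinP; apply: measurable_funM.
    by apply: (@measurable_fun_pair2 _ _ _ R R R); exact: measurable_indic.
  apply: measurable_funTV; apply: measurable_funT_sqrt.
  by apply: measurable_funB => //; exact: measurable_funX.
have J0 d1 : (0 <= (\1_(c @^-1` B) (r, d1) * (Num.sqrt (1 - d1 ^+ 2))^-1)%:E)%E.
  by rewrite lee_fin mulr_ge0// invr_ge0 sqrtr_ge0.
have -> : I r = (J * (2 / pi)%:E)%E.
  rewrite -ge0_integralZr//; first last.
  - by rewrite lee_fin divr_ge0 ?pi_ge0.
  - exact: measurable_funTS.
  rewrite [RHS]integral_mkcond; apply: eq_integral => x _.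
  rewrite patchE mem_setE/= in_itv/= /pdf_D; case: ifPn => _; last by rewrite mulr0.
  by rewrite -EFinM invfM; congr _%:E; ring.
have -> : (\int[mu]_(x in `]0%R, 1%R[)
     (F (r * x, r * Num.sqrt (1 - x ^+ 2))%R *
      ((Num.sqrt (1 - x ^+ 2))^-1)%:E) = J * ((pi * K)^-1 * g (r ^+ 2))%:E)%E.
  rewrite -ge0_integralZr//; first last.
  - by rewrite lee_fin mulr_ge0 ?g0 ?sqr_ge0// invr_ge0 mulr_ge0 ?pi_ge0// ltW.
  - exact: measurable_funTS.
  apply: eq_integral => x; rewrite inE/= in_itv/= => /andP[x0 x1].
  rewrite /F /spherical_pdf/= -!EFinM; congr _%:E.
  have -> : (r * x) ^+ 2 + (r * Num.sqrt (1 - x ^+ 2)) ^+ 2 = r ^+ 2.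
    rewrite [X in _ + X]exprMn sqr_sqrtr; first by ring.
    by rewrite subr_ge0 expr_le1 ?ltW.
  have -> : \1_(c @^-1` B) (r, x) =
      \1_B (r * x * e1, r * Num.sqrt (1 - x ^+ 2) * e2) :> R by [].
  by ring.
rewrite muleCA -!muleA -!EFinM; congr (_ * _%:E)%E.
have pi0 : pi != 0 :> R by rewrite gt_eqF ?pi_gt0.
have K_neq0 : K != 0 by rewrite gt_eqF.
by move: pi0; generalize (@pi R) => p p0; field; rewrite p0 K_neq0.
Qed.

(** The four sign patterns give four integrals over the positive quadrant; as the density is even in
    each coordinate, folding the plane along both axes yields the same four terms. *)
Lemma spherical_law (B : set (R * R)) : measurable B ->
  P (V1 @^-1` [set -1]) = (1 / 2)%:E -> P (V1 @^-1` [set 1]) = (1 / 2)%:E ->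
  P (V2 @^-1` [set -1]) = (1 / 2)%:E -> P (V2 @^-1` [set 1]) = (1 / 2)%:E ->
  P ((fun w => (Rr w * D w * V1 w, Rr w * Num.sqrt (1 - D w ^+ 2) * V2 w))
       @^-1` B) =
  (\int[mu]_x \int[mu]_y (\1_B (x, y) * spherical_pdf g K (x, y))%:E)%E.
Proof.
move=> mB PV1n PV1p PV2n PV2p.
set A := _ @^-1` B.
have mA : measurable A.
  rewrite -[A]setTI; apply: measurable_fun_pair => //.
    by apply: measurable_funM => //; exact: measurable_funM.
  apply: measurable_funM => //; apply: measurable_funM => //.
  apply: measurable_funT_sqrt.
  by apply: measurable_funB => //; exact: measurable_funX.
(* The two values of [V] have total probability 1, so the event that [V] is neither 1 nor -1 is
   null. *)
have sign_split (V : T -> R) (C : set T) : measurable_fun setT V -> measurable C ->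
    P (V @^-1` [set -1]) = (1 / 2)%:E -> P (V @^-1` [set 1]) = (1 / 2)%:E ->
    P C = (P (V @^-1` [set 1%R] `&` C) + P (V @^-1` [set (-1)%R] `&` C))%E.
  move=> mV mC Vn Vp.
  have mVp : measurable (V @^-1` [set 1]) by exact: measurable_preimage.
  have mVn : measurable (V @^-1` [set -1]) by exact: measurable_preimage.
  have dis : V @^-1` [set 1] `&` V @^-1` [set -1] = set0.
    apply/seteqP; split=> // w [/= e1 e2].
    have : (0 : R) < 1 by [].
    by rewrite -e1 e2 oppr_gt0 ltr10.
  have PU : P (~` (V @^-1` [set 1] `|` V @^-1` [set -1])) = 0%E.
    have half2 : 1 / 2 + 1 / 2 = 1 :> R by field.
    have PU1 : P (V @^-1` [set 1] `|` V @^-1` [set -1]) = 1%E.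
      rewrite measureU//; transitivity ((1 / 2)%:E + (1 / 2)%:E : \bar R)%E.
        by congr (_ + _)%E.
      by rewrite -EFinD half2.
    by rewrite probability_setC ?PU1 ?subee//; exact: measurableU.
  rewrite -measureU; [|exact: measurableI|exact: measurableI|]; last first.
    by rewrite setIACA dis set0I.
  rewrite -setIUl; apply/eqP; rewrite eq_le; apply/andP; split; last first.
    by apply: le_measure; rewrite ?inE//; apply: measurableI => //; exact: measurableU.
  rewrite -[leRHS]adde0 -PU.
  apply: le_trans (measureU2 _ _ _); last 2 first.
  - by apply: measurableI => //; exact: measurableU.
  - by apply: measurableC; exact: measurableU.
  apply: le_measure; rewrite ?inE//.
    apply: measurableU; last by apply: measurableC; exact: measurableU.
    by apply: measurableI => //; exact: measurableU.
  by move=> w Cw; have [?|?] := pselect ((V @^-1` [set 1] `|` V @^-1` [set -1]) w);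
    [left|right].
rewrite (sign_split V1)// [X in (X + _)%E](sign_split V2)//; last first.
  by apply: measurableI => //; exact: measurable_preimage.
rewrite [X in (_ + X)%E](sign_split V2)//; last first.
  by apply: measurableI => //; exact: measurable_preimage.
rewrite !setIA !(setIC (V2 @^-1` _) (V1 @^-1` _)) !spherical_law_quadrant//.
pose G (z : R * R) := (\1_B z * spherical_pdf g K z)%:E.
have mG : measurable_fun setT G.
  apply/measurable_EFinP; apply: measurable_funM; first exact: measurable_indic.
  exact: measurable_spherical_pdf.
have G0 z : (0 <= G z)%E by rewrite lee_fin mulr_ge0// spherical_pdf_ge0.
pose q e1 e2 x := (\int[mu]_(y in `]0%R, +oo[) G (x * e1, y * e2)%R)%E.
have mGq (e1 e2 : R) : measurable_fun setT (fun z : R * R => G (z.1 * e1, z.2 * e2)).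
  apply: (measurableT_comp mG).
  by apply: measurable_fun_pair; exact: measurable_funM.
have mq e1 e2 : measurable_fun setT (q e1 e2).
  pose Gq (z : R * R) := if 0 < z.2 then G (z.1 * e1, z.2 * e2) else 0%E.
  rewrite (_ : q e1 e2 = fun x => \int[mu]_y Gq (x, y))%E.
    apply: measurable_integral_lebesgue; last by move=> z; rewrite /Gq; case: ifP.
    by apply: measurable_fun_ifT => //; exact: measurable_fun_ltr.
  apply/funext => x; rewrite /q integral_mkcond; apply: eq_integral => y _.
  by rewrite patchE mem_setE/= in_itv/= andbT.
have q0 e1 e2 x : (0 <= q e1 e2 x)%E by apply: integral_ge0 => y _; exact: G0.
(* The density depends on squares only, so the signs may be moved inside it. *)
have qE (e1 e2 : R) : e1 ^+ 2 = 1 -> e2 ^+ 2 = 1 ->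
    (\int[mu]_(x in `]0%R, +oo[) \int[mu]_(y in `]0%R, +oo[)
     (\1_B (x * e1, y * e2)%R * spherical_pdf g K (x, y))%:E =
     \int[mu]_(x in `]0%R, +oo[) q e1 e2 x)%E.
  move=> e1E e2E; apply: eq_integral => x _; apply: eq_integral => y _.
  by rewrite /G /spherical_pdf/= !exprMn e1E e2E !mulr1.
rewrite !qE ?expr1n ?sqrrN ?expr1n//.
have mqD e1 e2 e3 e4 : measurable_fun setT (fun x => q e1 e2 x + q e3 e4 x)%E.
  exact: emeasurable_funD.
rewrite -!ge0_integralD//; try by move=> x _; rewrite adde_ge0.
all: try by apply: measurable_funTS; first [exact: mq | exact: mqD].
rewrite [RHS]ge0_integral_half.
- apply: eq_integral => x _.
  have half (z : R) : (\int[mu]_y G (z, y) =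
      \int[mu]_(y in `]0%R, +oo[) G (z, y) +
      \int[mu]_(y in `]0%R, +oo[) G (z, (- y)%R))%E.
    have mGz : measurable_fun setT (fun y => G (z, y)).
      exact: (@measurable_fun_pair2 _ _ _ R R _ G z).
    have mGzN : measurable_fun setT (fun y : R => G (z, - y)).
      exact: (@measurableT_comp _ _ _ R R _ (fun y => G (z, y)) setT -%R).
    rewrite ge0_integral_half// ge0_integralD//; exact: measurable_funTS.
  rewrite !half /q; congr (_ + _ + (_ + _))%E; apply: eq_integral => y _;
    by rewrite ?mulr1 ?mulrN1.
- exact: (measurable_integral_lebesgue mG).
- by move=> x; apply: integral_ge0 => y _; exact: G0.
Qed.

End law.
End spherical.

(** * The elliptical law as an affine image of the spherical law *)

Section elliptical.
Context {R : realType}.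
Local Notation mu := (@lebesgue_measure R).

Lemma det_Sigma2 (sigma rho : R) :
  \det (Sigma2 sigma rho) = sigma ^+ 2 * (1 - rho ^+ 2).
Proof.
rewrite (expand_det_row _ ord0) !big_ord_recl big_ord0 /cofactor !det_mx11 !mxE/=.
by ring.
Qed.

Lemma quad_formE (sigma rho mu1 mu2 : R) (y : R * R) :
  sigma != 0 -> 1 - rho ^+ 2 != 0 ->
  let a := y.1 - mu1 in let b := y.2 - mu2 in
  quad_form (Sigma2 sigma rho) mu1 mu2 y =
  (a ^+ 2 - 2 * rho * sigma * a * b + sigma ^+ 2 * b ^+ 2) /
    (sigma ^+ 2 * (1 - rho ^+ 2)).
Proof.
move=> s0 r0 a b.
(* [N] is the adjugate of the scale matrix over its determinant, that is, its explicit inverse. *)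
pose N : 'M[R]_2 := \matrix_(i < 2, j < 2)
  ((if i == j :> nat then (if i == 0%N :> nat then 1 else sigma ^+ 2)
    else - (rho * sigma)) / (sigma ^+ 2 * (1 - rho ^+ 2))).
have SN : Sigma2 sigma rho *m N = 1%:M.
  apply/matrixP => i j; rewrite !mxE !big_ord_recl big_ord0 !mxE/=.
  by case: i => -[|[|//]] ?; case: j => -[|[|//]] ?; rewrite /=; field; rewrite s0 r0.
have [uS _] := mulmx1_unit SN.
have -> : quad_form (Sigma2 sigma rho) mu1 mu2 y =
    (let v : 'rV[R]_2 := \row_(i < 2) (if (i == 0%N :> nat) then a else b) in
     (v *m N *m v^T) 0 0).
  by rewrite /quad_form -(mulKmx uS N) SN mulmx1.
rewrite /= !mxE !big_ord_recl big_ord0 !mxE/= !big_ord_recl !big_ord0 !mxE/=.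
by field; rewrite s0 r0.
Qed.

Variables (g : R -> R) (K mu1 mu2 sigma rho s : R).
Hypotheses (sigma0 : 0 < sigma) (hs : s ^+ 2 = 1 - rho ^+ 2) (s0 : s != 0).

(** With [a = sigma z] and [b = rho z + s w], completing the square turns the numerator of the
    quadratic form into [sigma ^ 2 ((b - rho z) ^ 2 + s ^ 2 z ^ 2)], which is
    [sigma ^ 2 s ^ 2 (z ^ 2 + w ^ 2)]. The root of the determinant is [sigma |s|], whatever the sign
    of [s]. *)
Lemma ell_pdf_affine z w :
  ell_pdf g K mu1 mu2 sigma rho (sigma * z + mu1, s * w + (mu2 + rho * z)) =
  (sigma * `|s|)^-1 * spherical_pdf g K (z, w).
Proof.
have r0 : 1 - rho ^+ 2 != 0 by rewrite -hs expf_neq0.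
have sg0 : sigma != 0 by rewrite gt_eqF.
rewrite /ell_pdf /spherical_pdf det_Sigma2 quad_formE// -hs.
rewrite sqrtrM ?sqr_ge0// !sqrtr_sqr (gtr0_norm sigma0) mulrA -invfM.
congr (_^-1 * g _); first by ring.
rewrite /= [in LHS]hs.
have -> : z ^+ 2 + w ^+ 2 = (sigma ^+ 2 * (z ^+ 2 * s ^+ 2 + w ^+ 2 * s ^+ 2)) /
    (sigma ^+ 2 * s ^+ 2) by field; rewrite sg0 s0.
congr (_ / _); rewrite ?hs//.
have -> : w ^+ 2 * (1 - rho ^+ 2) = (s * w) ^+ 2 by rewrite -hs; ring.
ring.
Qed.

(** An affine substitution in the outer variable, then one in the inner variable with a shift
    depending on [z], give the Jacobian [sigma |s|]; it cancels the constant of [ell_pdf_affine]. *)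
Lemma elliptical_law d (T : measurableType d) (P : probability T R)
    (Y U : T -> R) (B : set (R * R)) :
  is_pdf2 P Y U (ell_pdf g K mu1 mu2 sigma rho) -> measurable B ->
  P ((fun w => (Y w, U w)) @^-1` B) =
  (\int[mu]_z \int[mu]_w
     (\1_B (sigma * z + mu1, s * w + (mu2 + rho * z))%R *
      spherical_pdf g K (z, w))%:E)%E.
Proof.
move=> hYU mB; rewrite (is_pdf2E hYU mB); case: hYU => mell ell0 _.
pose G (z : R * R) := (\1_B z * ell_pdf g K mu1 mu2 sigma rho z)%:E.
have mG : measurable_fun setT G.
  by apply/measurable_EFinP; apply: measurable_funM => //; exact: measurable_indic.
have G0 z : (0 <= G z)%E by rewrite lee_fin mulr_ge0.
rewrite (@ge0_substitution_affine R sigma mu1 _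
  (fun x => \int[mu]_y G (x, y))%E) ?gt_eqF//; last 2 first.
- exact: measurable_integral_lebesgue.
- by move=> x; apply: integral_ge0 => y _; exact: G0.
apply: eq_integral => z _.
have mGx x : measurable_fun setT (fun y => G (x, y)).
  exact: (@measurable_fun_pair2 _ _ _ R R _ G x).
rewrite (@ge0_substitution_affine R s (mu2 + rho * z) _
  (fun y => G (sigma * z + mu1, y)))//.
have maff : measurable_fun setT (fun y : R => s * y + (mu2 + rho * z)).
  by apply: measurable_funD => //; exact: measurable_funM.
rewrite -ge0_integralZr//; first last.
- by move=> y _; rewrite mule_ge0 ?lee_fin//; exact: G0.
- by apply: emeasurable_funM => //; exact: (measurableT_comp (mGx _) maff).
apply: eq_integral => w _; rewrite /G ell_pdf_affine -!EFinM; congr _%:E.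
rewrite (gtr0_norm sigma0); have sg0 : sigma != 0 by rewrite gt_eqF.
have ns0 : `|s| != 0 by rewrite normr_eq0.
by field; rewrite sg0 ns0.
Qed.

End elliptical.

(** * Truncation of the second coordinate below a threshold *)

Section conditional.
Context {R : realType} {d : measure_display} {T : measurableType d}.
Variable P : probability T R.
Local Notation mu := (@lebesgue_measure R).
Variables (X Y : T -> R) (fX : R -> R) (fXY : R * R -> R).
Hypotheses (hX : is_pdf P X fX) (hXY : is_pdf2 P X Y fXY).

Let mfX : measurable_fun setT fX. Proof. by case: hX. Qed.
Let fX0 x : 0 <= fX x. Proof. by case: hX. Qed.
Let mfXY : measurable_fun setT fXY. Proof. by case: hXY. Qed.
Let fXY0 z : 0 <= fXY z. Proof. by case: hXY. Qed.

Let mfXYE : measurable_fun setT (EFin \o fXY).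
Proof. exact/measurable_EFinP. Qed.

Let mfXYx x : measurable_fun setT (fun y => (fXY (x, y))%:E : \bar R).
Proof. exact: (@measurable_fun_pair2 _ _ _ R R _ (EFin \o fXY) x). Qed.

(** Both functions integrate to the probability of [X] in [E] over every measurable [E]. PDFs are
    fixed only up to null sets, so equality almost everywhere is what can be expected. *)
Lemma ae_eq_marginal_pdf :
  ae_eq mu setT (EFin \o fX) (fun x => \int[mu]_y (fXY (x, y))%:E)%E.
Proof.
have mfXE : measurable_fun setT (EFin \o fX) by exact/measurable_EFinP.
have mM : measurable_fun setT (fun x => \int[mu]_y (fXY (x, y))%:E)%E.
  by apply: (measurable_integral_lebesgue mfXYE) => z; rewrite lee_fin.
apply: integral_ae_eq => //.
  apply/integrableP; split => //.
  under eq_integral do rewrite /= ger0_norm//.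
  case: hX => _ _ <- //; rewrite preimage_setT probability_setT ltry//.
move=> E _ mE.
have -> : (\int[mu]_(x in E) (EFin \o fX) x)%E = P (X @^-1` E) by case: hX => _ _ ->.
have -> : X @^-1` E = (fun w => (X w, Y w)) @^-1` (E `*` setT).
  by apply/seteqP; split=> w //= [].
rewrite (is_pdf2E hXY); last exact: measurableX.
rewrite [RHS]integral_mkcond; apply: eq_integral => x _; rewrite patchE.
case: ifPn => xE.
  apply: eq_integral => y _; rewrite indicE mem_set ?mul1r//=; split => //.
  exact: set_mem.
rewrite integral0_eq// => y _; rewrite indicE memNset ?mul0r//= => -[/mem_set].
by rewrite (negbTE xE).
Qed.

Variable x : R -> R.
Hypothesis mx : measurable_fun setT x.

(** The density of [X] on the event [Y < x X], written through [Gfun] with the same convention at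
    zeros of [fX] as in [cond_density]. *)
Definition truncated_density (z : R) : R :=
  if 0 < fX z then fX z * fine (Gfun fX fXY z (x z)) else 0.

Lemma truncated_density_ge0 z : 0 <= truncated_density z.
Proof.
rewrite /truncated_density; case: ifP => // _; rewrite mulr_ge0// fine_ge0//.
by apply: integral_ge0 => w _; rewrite lee_fin divr_ge0.
Qed.

Let mlex : measurable_fun setT (fun z : R * R => z.2 <= x z.1).
Proof. by apply: measurable_fun_ler => //; exact: (measurableT_comp mx). Qed.

Lemma measurable_truncated_density : measurable_fun setT truncated_density.
Proof.
apply: measurable_fun_ifT => //; first exact: measurable_fun_ltr.
apply: measurable_funM => //.
(* The moving upper limit is absorbed into a jointly measurable integrand, so that measurability of
   the section integrals applies. *)
pose F (z : R * R) : \bar R := if z.2 <= x z.1 then (fXY z / fX z.1)%:E else 0%E.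
have mF : measurable_fun setT F.
  apply: measurable_fun_ifT => //; apply/measurable_EFinP.
  apply: measurable_funM => //; apply: measurable_funTV.
  exact: (measurableT_comp mfX).
rewrite (_ : (fun _ => fine _) = fine \o (fun z => \int[mu]_w F (z, w)))%E.
  apply: measurableT_comp; first exact: fine_measurable.
  apply: (measurable_integral_lebesgue mF) => z; rewrite /F; case: ifP => // _.
  by rewrite lee_fin divr_ge0.
apply/funext => z /=; congr fine; rewrite /Gfun integral_mkcond.
by apply: eq_integral => w _; rewrite patchE mem_setE/= in_itv.
Qed.

(** Tonelli gives the integral over [A] of the partial marginal [N]. Almost everywhere [N <= fX], so
    [N] vanishes with [fX], and elsewhere dividing and multiplying by [fX] restores [N]. *)
Lemma integral_truncated_density (A : set R) : measurable A ->
  P ((fun w => (X w, Y w)) @^-1` [set z | A z.1 /\ z.2 < x z.1]) =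
  (\int[mu]_(z in A) (truncated_density z)%:E)%E.
Proof.
move=> mA.
have mB : measurable [set z : R * R | A z.1 /\ z.2 < x z.1].
  rewrite (_ : [set z | _] = fst @^-1` A `&` (fun z => z.2 < x z.1) @^-1` [set true]).
    apply: measurableI.
      by rewrite -[_ @^-1` _]setTI; exact: measurable_fst.
    rewrite -[_ @^-1` _]setTI; apply: measurable_fun_ltr => //.
    exact: (measurableT_comp mx).
  by apply/seteqP; split=> z /= [].
rewrite (is_pdf2E hXY mB).
pose N z := (\int[mu]_(w in `]-oo, x z]) (fXY (z, w))%:E)%E.
transitivity (\int[mu]_(z in A) N z)%E.
  rewrite [RHS]integral_mkcond; apply: eq_integral => z _; rewrite patchE.
  case: ifPn => zA; last first.
    rewrite integral0_eq// => w _; rewrite indicE memNset ?mul0r//= => -[/mem_set].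
    by rewrite (negbTE zA).
  (* The event is strict while [Gfun] integrates up to and including the threshold; the endpoint is
     negligible. *)
  rewrite /N -integral_itv_bndo_bndc; last exact: measurable_funTS.
  rewrite [RHS]integral_mkcond; apply: eq_integral => w _.
  rewrite patchE mem_setE/= in_itv/= indicE.
  case: ifPn => wx; first by rewrite mem_set ?mul1r//=; split => //; exact: set_mem.
  by rewrite memNset ?mul0r//= => -[_]; rewrite (negbTE wx).
have mN : measurable_fun setT N.
  pose F (z : R * R) : \bar R := if z.2 <= x z.1 then (fXY z)%:E else 0%E.
  rewrite (_ : N = fun z => \int[mu]_w F (z, w))%E.
    apply: measurable_integral_lebesgue.
      exact: measurable_fun_ifT.
    by move=> z; rewrite /F; case: ifP => // _; rewrite lee_fin.
  apply/funext => z; rewrite /N integral_mkcond.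
  by apply: eq_integral => w _; rewrite patchE mem_setE/= in_itv.
have N0 z : (0 <= N z)%E by apply: integral_ge0 => w _; rewrite lee_fin.
apply: ge0_ae_eq_integral => //.
- exact: measurable_funTS.
- apply: measurable_funTS; apply/measurable_EFinP.
  exact: measurable_truncated_density.
- by move=> z _; rewrite lee_fin truncated_density_ge0.
apply: filterS ae_eq_marginal_pdf => z /(_ I)/= fXE _.
have NfX : (N z <= (fX z)%:E)%E.
  rewrite fXE; apply: ge0_subset_integral => //.
    exact: mfXYx.
  by move=> w _; rewrite lee_fin.
rewrite /truncated_density; case: ifPn => fXz; last first.
  apply/eqP; rewrite eq_le N0 andbT (le_trans NfX)// lee_fin.
  by rewrite leNgt.
(* Finiteness is needed because [truncated_density] takes [fine] of [Gfun], which would send an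
   infinite value to 0. *)
have Nfin : N z \is a fin_num by rewrite ge0_fin_numE// (le_lt_trans NfX) ?ltry.
have -> : Gfun fX fXY z (x z) = (N z * ((fX z)^-1)%:E)%E.
  rewrite -ge0_integralZr//; first last.
  - by rewrite lee_fin invr_ge0.
  - by move=> w _; rewrite lee_fin.
  - by apply: measurable_funTS; exact: mfXYx.
by rewrite fineM//= mulrCA mulfV ?gt_eqF// mulr1 fineK.
Qed.

End conditional.

(** * The probability of [Us > 0] and the density of [Ys] given this event *)

Theorem theorem1 (R : realType)
  (* density generator g_c : [0,oo) -> [0,oo), normalising constant K *)
  (g : R -> R) (K : R)
  (hg_meas : measurable_fun (`[0%R, +oo[ : set R) g)
  (hg_nonneg : forall u, 0 <= u -> 0 <= g u)
  (hK : (\int[lebesgue_measure]_(u in `[0%R, +oo[) (g u)%:E)%E = K%:E)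
  (hK0 : 0 < K)
  (* parameters *)
  (mu1 mu2 sigma rho : R) (hsigma : 0 < sigma) (hrho : -1 < rho < 1)
  (* the random vector (Ys, Us) with the elliptical PDF *)
  (d1 : measure_display) (Omega1 : measurableType d1) (P1 : probability Omega1 R)
  (Ys Us : Omega1 -> R)
  (hYs : measurable_fun setT Ys) (hUs : measurable_fun setT Us)
  (hYU : is_pdf2 P1 Ys Us (ell_pdf g K mu1 mu2 sigma rho))
  (* the stochastic representation V1, V2, R, D *)
  (d2 : measure_display) (Omega2 : measurableType d2) (P2 : probability Omega2 R)
  (V1 V2 Rr D : Omega2 -> R)
  (hV1m : measurable_fun setT V1) (hV2m : measurable_fun setT V2)
  (hRm : measurable_fun setT Rr) (hDm : measurable_fun setT D)
  (hindep : mutually_independent4 P2 V1 V2 Rr D)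
  (hV1a : P2 (V1 @^-1` [set -1]) = (1 / 2)%:E)
  (hV1b : P2 (V1 @^-1` [set 1]) = (1 / 2)%:E)
  (hV2a : P2 (V2 @^-1` [set -1]) = (1 / 2)%:E)
  (hV2b : P2 (V2 @^-1` [set 1]) = (1 / 2)%:E)
  (hD : is_pdf P2 D pdf_D)
  (hR : is_pdf P2 Rr (pdf_R g K))
  (* PDFs of Z1, (Z1, Z2) and rho Z1 + sqrt(1 - rho^2) Z2 *)
  (fZ1 : R -> R) (fZ12 : R * R -> R) (fS : R -> R)
  (hfZ1 : is_pdf P2 (fun w => Rr w * D w * V1 w) fZ1)
  (hfZ12 : is_pdf2 P2 (fun w => Rr w * D w * V1 w)
                      (fun w => Rr w * Num.sqrt (1 - D w ^+ 2) * V2 w) fZ12)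
  (hfS : is_pdf P2 (fun w => rho * (Rr w * D w * V1 w) +
                            Num.sqrt (1 - rho ^+ 2) *
                              (Rr w * Num.sqrt (1 - D w ^+ 2) * V2 w)) fS) :
  P1 (Us @^-1` `]0%R, +oo[) = Hfun fS mu2 /\
  ((0 < P1 (Us @^-1` `]0%R, +oo[))%E ->
   is_cond_pdf P1 Ys (Us @^-1` `]0%R, +oo[)
     (cond_density fZ1 fZ12 fS mu1 mu2 sigma rho)).
Proof.
have [rhoN1 rho1] := andP hrho.
have t2_gt0 : 0 < 1 - rho ^+ 2.
  have -> : 1 - rho ^+ 2 = (1 - rho) * (1 + rho) by ring.
  by rewrite mulr_gt0 ?subr_gt0// -[1 + rho]opprK opprD oppr_gt0; lra.
set t := Num.sqrt (1 - rho ^+ 2) in hfS *.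
have t0 : 0 < t by rewrite sqrtr_gt0.
have t2 : t ^+ 2 = 1 - rho ^+ 2 by rewrite sqr_sqrtr// ltW.
set Z1 := (fun w => Rr w * D w * V1 w) in hfZ1 hfZ12.
set Z2 := (fun w => Rr w * Num.sqrt (1 - D w ^+ 2) * V2 w) in hfZ12.
(* The two vectors live on different spaces; their laws are compared through the common integral of
   [spherical_pdf]. The sign of [s] is left open, as both roots are used. *)
have transfer (s : R) (B : set (R * R)) : s ^+ 2 = 1 - rho ^+ 2 -> s != 0 ->
    measurable B -> P1 ((fun w => (Ys w, Us w)) @^-1` B) =
    P2 ((fun w => (Z1 w, Z2 w)) @^-1`
        ((fun z => (sigma * z.1 + mu1, s * z.2 + (mu2 + rho * z.1))) @^-1` B)).
  move=> hs s0 mB.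
  rewrite (elliptical_law hsigma hs s0 hYU mB).
  have maff : measurable_fun setT
      (fun z : R * R => (sigma * z.1 + mu1, s * z.2 + (mu2 + rho * z.1))).
    apply: measurable_fun_pair; apply: measurable_funD => //.
    - exact: measurable_funM.
    - exact: measurable_funM.
    - by apply: measurable_funD => //; exact: measurable_funM.
  rewrite (spherical_law hg_meas hg_nonneg hK0 hV1m hV2m hRm hDm hindep hD hR)//.
  by rewrite -[_ @^-1` B]setTI; exact: maff.
have mpos : measurable (`]0%R, +oo[ : set R) by exact: measurable_itv.
have PU : P1 (Us @^-1` `]0%R, +oo[) = Hfun fS mu2.
  transitivity (P1 ((fun w => (Ys w, Us w)) @^-1` (setT `*` `]0%R, +oo[))).
    by congr (P1 _); apply/seteqP; split=> w //= [].
  (* With the positive root, [Us > 0] becomes [rho Z1 + t Z2 > - mu2], the domain of integration in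
     [Hfun]. *)
  rewrite (transfer t)//; [|by rewrite gt_eqF|exact: measurableX].
  case: hfS => _ _ HS; rewrite /Hfun -HS//; congr (P2 _).
  by apply/seteqP; split=> w /=; rewrite !in_itv/= !andbT /Z1 /Z2;
    [case=> _|move=> ?; split=> //]; lra.
split; [exact: PU|move=> U0].
set E := Us @^-1` _ in PU U0 *.
pose x (z : R) := mu2 / t + rho / t * z.
have mx : measurable_fun setT x.
  by apply: measurable_funD => //; exact: measurable_funM.
pose h := fine (P1 E).
have h0 : 0 < h.
  by rewrite fine_gt0// U0 /= (le_lt_trans (probability_le1 _ _))// ?ltry//; exact: measurable_preimage.
pose q := truncated_density fZ1 fZ12 x.
have q0 z : 0 <= q z by exact: (truncated_density_ge0 hfZ1 hfZ12).
have mq : measurable_fun setT q by exact: (measurable_truncated_density hfZ1 hfZ12).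
(* By [PU] the denominator is the probability [h] of the event, so the claimed density is [q]
   transported by [y = sigma z + mu1] and divided by [h]. *)
have -> : cond_density fZ1 fZ12 fS mu1 mu2 sigma rho =
    fun y : R => sigma^-1 * q ((y - mu1) / sigma) / h.
  apply/funext => y; rewrite /cond_density /q /truncated_density -PU -/t -/(x _).
  by case: ifP => _; rewrite ?mulrA// mulr0 mul0r.
have mcond : measurable_fun setT (fun y : R => sigma^-1 * q ((y - mu1) / sigma) / h).
  apply: measurable_funM => //; apply: measurable_funM => //.
  apply: (measurableT_comp mq); apply: measurable_funM => //.
  exact: measurable_funB.
have cond0 y : 0 <= sigma^-1 * q ((y - mu1) / sigma) / h.
  by rewrite !mulr_ge0// invr_ge0 ltW.
split=> // A mA.
pose A' := (fun z : R => sigma * z + mu1) @^-1` A.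
have maff : measurable_fun setT (fun z : R => sigma * z + mu1).
  by apply: measurable_funD => //; exact: measurable_funM.
have mA' : measurable A' := measurable_preimage maff mA.
have PA : P1 (Ys @^-1` A `&` E) = (\int[lebesgue_measure]_(z in A') (q z)%:E)%E.
  rewrite -(integral_truncated_density hfZ1 hfZ12 mx mA').
  transitivity (P1 ((fun w => (Ys w, Us w)) @^-1` (A `*` `]0%R, +oo[))) => //.
  (* With the negative root, [Us > 0] becomes [t Z2 < mu2 + rho Z1], that is [Z2 < x Z1]; the first
     coordinate is still [sigma Z1 + mu1]. *)
  rewrite (transfer (- t)) ?sqrrN ?oppr_eq0 ?gt_eqF//; last exact: measurableX.
  congr (P2 _); apply/seteqP.
  have xE w : (0 < - t * Z2 w + (mu2 + rho * Z1 w)) = (Z2 w < x (Z1 w)).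
    have -> : x (Z1 w) = (mu2 + rho * Z1 w) / t by rewrite /x; ring.
    rewrite ltr_pdivlMr// -[RHS]subr_gt0.
    by have -> : - t * Z2 w + (mu2 + rho * Z1 w) = mu2 + rho * Z1 w - Z2 w * t by ring.
  by split=> w /=; rewrite !in_itv/= andbT xE.
(* The substitution [y = sigma z + mu1] turns [A] into [A'], and its Jacobian cancels the factor
   [sigma^-1]. *)
rewrite PA [RHS]integral_mkcond (@ge0_substitution_affine R sigma mu1) ?gt_eqF//; first last.
- by move=> y; rewrite patchE; case: ifP; rewrite ?lee_fin.
- apply/(measurable_restrictT _ _).1 => //; apply: measurable_funTS.
  exact/measurable_EFinP.
transitivity (\int[lebesgue_measure]_z (((EFin \o q) \_ A') z * (h^-1)%:E))%E.
  rewrite ge0_integralZr//; first last.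
  - by rewrite lee_fin invr_ge0 ltW.
  - by move=> z _; rewrite patchE; case: ifP; rewrite ?lee_fin.
  - apply/(measurable_restrictT _ _).1 => //; apply: measurable_funTS.
    exact/measurable_EFinP.
  rewrite -integral_mkcond EFinM fineK// -PA fin_num_measure//.
  by apply: measurableI; exact: measurable_preimage.
apply: eq_integral => z _; rewrite !patchE.
have -> : (sigma * z + mu1 \in A) = (z \in A') by [].
case: ifP => _; last by rewrite !mul0e.
rewrite -!EFinM (gtr0_norm hsigma) addrK; congr _%:E.
have sg0 : sigma != 0 by rewrite gt_eqF.
have hn0 : h != 0 by rewrite gt_eqF.
have -> : sigma * z / sigma = z by rewrite mulrAC divff// mul1r.
by field; rewrite sg0 hn0.
Qed.
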